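(* Let $(\mathbb S,\mathbf d)$ be a complete separable metric space and $\mathbb C\subseteq\mathbb S$ a Borel set. Let $\Theta$ be a set of indices, and let $\mu^\eta_\theta,\mu_\theta\in\mathbb M(\mathbb S\setminus\mathbb C)$ for each $\eta>0$ and $\theta\in\Theta$. Suppose that for any sequence $(\mu_{\theta_n})_{n\ge1}$ (with $\theta_n\in\Theta$) there exist a subsequence $(\mu_{\theta_{n_k}})_{k\ge1}$ and some $\theta^*\in\Theta$ such that $\lim_{k\to\infty}\mu_{\theta_{n_k}}(f)=\mu_{\theta^*}(f)$ for all $f\in\mathcal C(\mathbb S\setminus\mathbb C)$. Then the following three statements are equivalent: (i) $\mu^\eta_\theta$ converges to $\mu_\theta$ in $\mathbb M(\mathbb S\setminus\mathbb C)$ uniformly in $\theta$ on $\Theta$ as $\eta\downarrow0$; (ii) $\lim_{\eta\downarrow0}\sup_{\theta\in\Theta}|\mu^\eta_\theta(f)-\mu_\theta(f)|=0$ for each $f\in\mathcal C(\mathbb S\setminus\mathbb C)$ that is also uniformly continuous on $\mathbb S$; (iii) $\limsup_{\eta\downarrow0}\sup_{\theta\in\Theta}\big(\mu^\eta_\theta(F)-\mu_\theta(F^\epsilon)\big)\le0$ and $\liminf_{\eta\downarrow0}\inf_{\theta\in\Theta}\big(\mu^\eta_\theta(G)-\mu_\theta(G_\epsilon)\big)\ge0$ for all $\epsilon>0$, all closed $F\subseteq\mathbb S$ bounded away from $\mathbb C$, and all open $G\subseteq\mathbb S$ bounded away from $\mathbb C$. Furthermore, any of (i)--(iii) implies: (iv)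 $\limsup_{\eta\downarrow0}\sup_{\theta\in\Theta}\mu^\eta_\theta(F)\le\sup_{\theta\in\Theta}\mu_\theta(F)$ and $\liminf_{\eta\downarrow0}\inf_{\theta\in\Theta}\mu^\eta_\theta(G)\ge\inf_{\theta\in\Theta}\mu_\theta(G)$ for all closed $F\subseteq\mathbb S$ bounded away from $\mathbb C$ and all open $G\subseteq\mathbb S$ bounded away from $\mathbb C$.
   Context: For $E\subseteq\mathbb S$ and $r>0$: $\mathbf d(E,y)=\inf_{x\in E}\mathbf d(x,y)$ (with $\inf\emptyset=\infty$), the $r$-enlargement is $E^r=\{y\in\mathbb S:\mathbf d(E,y)\le r\}$ and the $r$-shrinkage is $E_r=((E^c)^r)^c$. Sets $A,B$ are bounded away from each other if $\inf_{x\in A,y\in B}\mathbf d(x,y)>0$. $\mathbb M(\mathbb S\setminus\mathbb C)$ is the set of Borel measures $\nu$ on $\mathbb S\setminus\mathbb C$ with $\nu(\mathbb S\setminus\mathbb C^r)<\infty$ for all $r>0$. $\mathcal C(\mathbb S\setminus\mathbb C)$ is the set of real-valued, non-negative, bounded, continuous functions $f$ on $\mathbb S\setminus\mathbb C$ whose support is bounded away from $\mathbb C$ (i.e. $f=0$ on $\mathbb C^r$ for some $r>0$; such $f$ is regarded as a function on $\mathbb S$ by setting it to $0$ on $\mathbb C$). Write $\nu(f)=\int f\,d\nu$. ''$\mu^\eta_\theta$ converges to $\mu_\theta$ in $\mathbb M(\mathbb S\setminus\mathbb C)$ uniformly in $\theta$ on $\Theta$ as $\eta\downarrow0$'' means $\lim_{\eta\downarrow0}\sup_{\theta\in\Theta}|\mu^\eta_\theta(f)-\mu_\theta(f)|=0$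 for every $f\in\mathcal C(\mathbb S\setminus\mathbb C)$. *)

(* Defs.v *)
From HB Require Import structures.
From mathcomp Require Import all_boot all_order all_algebra.
From mathcomp Require Import all_classical all_reals all_analysis.

Set Implicit Arguments.
Unset Strict Implicit.
Unset Printing Implicit Defensive.

Import Order.TTheory GRing.Theory Num.Theory.
Import numFieldTopology.Exports numFieldNormedType.Exports.

Local Open Scope classical_set_scope.
Local Open Scope ring_scope.

#[short(type="completeMetricType")]
HB.structure Definition CompleteMetric (R : numDomainType) :=
  {S of Metric R S & Complete S}.

Definition separable (S : topologicalType) : Prop :=
  exists2 D : set S, countable D & dense D.

Notation borel S := (g_sigma_algebraType (@open S)).

Section Metric.
Variables (R : realType) (S : metricType R).
Implicit Types (A B E : set S) (r : R).

Definition dist_set E (y : S) : \bar R :=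
  ereal_inf [set (mdist x y)%:E | x in E].

Definition enlargement E r : set S := [set y | (dist_set E y <= r%:E)%E].

Definition shrinkage E r : set S := ~` enlargement (~` E) r.

Definition bounded_away A B : Prop :=
  (0 < ereal_inf [set (mdist x.1 x.2)%:E | x in A `*` B])%E.

(* An element of C(S \ CC), already extended by 0 to all of S: the vanishing
   condition forces f = 0 on CC, and continuity is only asked on S \ CC. *)
Definition test_fun (CC : set S) (f : S -> R) : Prop :=
  [/\ forall x, 0 <= f x,
      exists M : R, forall x, f x <= M,
      {within ~` CC, continuous f} &
      exists2 r : R, 0 < r & forall x, enlargement CC r x -> f x = 0].

End Metric.

Section MeasuresOffC.
Variables (R : realType) (S : completeMetricType R) (CC : set S).

(* For a Borel set CC, a Borel measure on S \ CC is the same thing as a Borel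
   measure on S that does not charge CC: extend by nu A := nu (A `\` CC). *)
Definition off_measure (nu : {measure set (borel S) -> \bar R}) : Prop :=
  nu CC = 0%E /\
  forall r : R, 0 < r -> (nu (~` enlargement CC r) < +oo)%E.

Definition pairing (nu : {measure set (borel S) -> \bar R}) (f : S -> R)
  : \bar R := (\int[nu]_x (f x)%:E)%E.

Section Family.
Variables (Theta : Type).
Variables (mueta : R -> Theta -> {measure set (borel S) -> \bar R}).
Variables (mu : Theta -> {measure set (borel S) -> \bar R}).

(* The supremum of a family of nonnegative numbers is taken in [0, +oo]; the
   maximum with 0 only matters when Theta is empty. *)
Definition unif_gap (f : S -> R) (eta : R) : \bar R :=
  maxe 0%E (ereal_sup (range (fun theta =>
    `|pairing (mueta eta theta) f - pairing (mu theta) f|%E))).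

Definition unif_cvg_off : Prop :=
  forall f, test_fun CC f -> unif_gap f eta @[eta --> 0^'+] --> 0%E.

End Family.
End MeasuresOffC.

(* Main.v *)
(* (ii) => (iii) sandwiches indicators of F and G_eps between Lipschitz test functions of
   the distance to F, resp. to the complement of G. For (iii) => (i) and (iii) => (iv),
   a failure of uniformity yields eta_k -> 0+ and theta_k with mu_{theta_k} -> mu_*; then
   (iii) gives, for nu_k = mu^{eta_k}_{theta_k}, limsup nu_k(F) <= mu_*(F) and
   liminf nu_k(G) >= mu_*(G), comparing mu_{theta_k}(F^eps) and mu_{theta_k}(G_eps) with
   test functions and letting eps -> 0. Hence (iv), and cutting a test function f into
   finitely many level sets, nu_k(f) -> mu_*(f), hence (i). *)

Require Import Defs.
From HB Require Import structures.
From mathcomp Require Import all_boot all_order all_algebra.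
From mathcomp Require Import all_classical all_reals all_analysis.
From mathcomp Require Import measurable_realfun lra ring.

Set Implicit Arguments.
Unset Strict Implicit.
Unset Printing Implicit Defensive.

Import Order.TTheory GRing.Theory Num.Theory.
Import numFieldTopology.Exports numFieldNormedType.Exports.

Local Open Scope classical_set_scope.
Local Open Scope ring_scope.

(** * Distance to a set, enlargements, and Lipschitz cutoff functions *)

Section MetricSets.
Variables (R : realType) (S : metricType R).
Implicit Types (E : set S) (x y : S) (r s b : R).

Lemma dist_set_ge0 E x : (0 <= dist_set E x)%E.
Proof. by apply: le_ereal_inf_tmp => _ [y _ <-]; rewrite lee_fin mdist_ge0. Qed.

Lemma dist_set_le E x y : (dist_set E x <= dist_set E y + (mdist y x)%:E)%E.
Proof.
rewrite -leeBlDr//; apply: le_ereal_inf_tmp => _ [z Ez <-].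
rewrite leeBlDr// -EFinD.
apply: le_trans (_ : ((mdist z x)%:E <= _)%E); last by rewrite lee_fin metric_triangle.
by apply: ereal_inf_lbound; exists z.
Qed.

Lemma dist_set_eq0 E x : E x -> dist_set E x = 0%E.
Proof.
move=> Ex; apply/eqP; rewrite eq_le dist_set_ge0 andbT.
by apply: ereal_inf_lbound; exists x => //; rewrite mdistxx.
Qed.

(* Truncating keeps the distance real-valued when [E] is empty. *)
Definition trunc_dist E b x : R := fine (mine (dist_set E x) b%:E).

Lemma trunc_distE E b x : 0 <= b -> (trunc_dist E b x)%:E = mine (dist_set E x) b%:E.
Proof.
move=> b0; rewrite /trunc_dist fineK// ge0_fin_numE.
  by rewrite gt_min ltry orbT.
by rewrite le_min dist_set_ge0 lee_fin.
Qed.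

Lemma trunc_dist_ltE E b s x : 0 <= b -> s <= b ->
  (trunc_dist E b x < s) = (dist_set E x < s%:E)%E.
Proof.
by move=> b0 sb; rewrite -lte_fin trunc_distE// gt_min [X in _ || X]lte_fin (ltNge b) sb orbF.
Qed.

Lemma trunc_dist_leE E b s x : 0 <= b -> s < b ->
  (trunc_dist E b x <= s) = (dist_set E x <= s%:E)%E.
Proof.
by move=> b0 sb; rewrite -lee_fin trunc_distE// ge_min [X in _ || X]lee_fin (leNgt b) sb orbF.
Qed.

Lemma trunc_dist_lipschitz E b x y : 0 <= b ->
  `|trunc_dist E b x - trunc_dist E b y| <= mdist x y.
Proof.
move=> b0.
(* By symmetry of the distance a one-sided bound is enough. If the minimum at [v] is the distance,
   it follows from [dist_set_le]; if it is [b], then [b] already bounds the value at [u]. *)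
suff H u v : trunc_dist E b u <= trunc_dist E b v + mdist u v.
  rewrite ler_distl lerBlDr H.
  by rewrite metric_sym H.
rewrite -lee_fin EFinD !trunc_distE// metric_sym.
case: (leP (dist_set E v)) => vb.
  by rewrite ge_min dist_set_le.
by rewrite ge_min -EFinD lee_fin lerDl mdist_ge0 orbT.
Qed.

Lemma lipschitz_unif_continuous (f : S -> R) (k : R) :
  (forall x y, `|f x - f y| <= k * mdist x y) -> unif_continuous f.
Proof.
move=> fk; apply/unif_continuousP => e e0.
(* [k] carries no sign condition, so [e] is divided by a positive constant above it. *)
have k0 : 0 < `|k| + 1 by rewrite ltr_wpDl.
exists (e / (`|k| + 1)); first by rewrite divr_gt0.
move=> [x y] /=; rewrite ballEmdist /= ltr_pdivlMr// => xy.
apply: le_lt_trans (fk x y) (le_lt_trans _ xy).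
rewrite mulrC ler_wpM2l ?mdist_ge0//.
by rewrite (le_trans (ler_norm k))// lerDl.
Qed.

Lemma unif_continuous_continuous (f : S -> R) : unif_continuous f -> continuous f.
Proof.
move=> /unif_continuousP fu x; apply/cvg_ballP => e /fu[d d0 fd].
by near=> y; apply: (fd (x, y)); near: y; exact: nbhsx_ballx.
Unshelve. all: by end_near. Qed.

Lemma trunc_dist_continuous E b : 0 <= b -> continuous (trunc_dist E b).
Proof.
move=> b0; apply: unif_continuous_continuous.
by apply: (@lipschitz_unif_continuous _ 1) => x y; rewrite mul1r trunc_dist_lipschitz.
Qed.

Lemma open_dist_set_lt E r : open [set x | (dist_set E x < r%:E)%E].
Proof.
have [r0|r0] := leP 0 r; last first.
  rewrite (_ : mkset _ = set0); first exact: open0.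
  apply/seteqP; split => // x /=; apply/negP.
  by rewrite -leNgt (le_trans _ (dist_set_ge0 _ _))// lee_fin ltW.
rewrite (_ : mkset _ = trunc_dist E r @^-1` [set s | s < r]).
  by apply: open_comp; [move=> x _; exact: trunc_dist_continuous|exact: open_lt].
by apply/seteqP; split => x /=; rewrite trunc_dist_ltE.
Qed.

Lemma closed_enlargement E r : closed (enlargement E r).
Proof.
have [r0|r0] := leP 0 r; last first.
  rewrite (_ : enlargement _ _ = set0); first exact: closed0.
  apply/seteqP; split => // x; rewrite /enlargement/=; apply/negP.
  by rewrite -ltNge (lt_le_trans _ (dist_set_ge0 _ _))// lte_fin.
(* The truncation level exceeds [r]: at level [r] itself the weak sublevel set would be all of [S].
   For the strict sublevel set in [open_dist_set_lt], level [r] is harmless. *)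
rewrite (_ : enlargement _ _ = trunc_dist E (r + 1) @^-1` [set s | s <= r]).
  apply: closed_comp; last exact: closed_le.
  by move=> x _; apply: trunc_dist_continuous; rewrite addr_ge0.
by apply/seteqP; split => x /=; rewrite trunc_dist_leE ?addr_ge0 ?ltrDl.
Qed.

(** The cutoff falls linearly in the distance, from 1 at distance [a] to 0 at distance [b], so it is
    Lipschitz with constant [(b - a)^-1]. Truncating the distance at [b] keeps it nonnegative. *)
Lemma urysohn_dist E a b : 0 <= a -> a < b -> exists g : S -> R,
  [/\ forall x, 0 <= g x <= 1,
      forall x, (dist_set E x <= a%:E)%E -> g x = 1,
      forall x, (b%:E <= dist_set E x)%E -> g x = 0 &
      unif_continuous g].
Proof.
move=> a0 ab; have b0 : 0 <= b by rewrite (le_trans a0)// ltW.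
have ba : 0 < b - a by rewrite subr_gt0.
exists (fun x => Num.min 1 ((b - trunc_dist E b x) / (b - a))); split.
- move=> x; rewrite ge_min lexx le_min ler01/= andbT divr_ge0 ?(ltW ba)//.
  by rewrite subr_ge0 -lee_fin trunc_distE// ge_min lexx orbT.
- move=> x; rewrite -(@trunc_dist_leE _ b)// => xa; apply/min_idPl.
  by rewrite ler_pdivlMr// mul1r lerD2l lerN2.
- move=> x bx; rewrite (_ : trunc_dist E b x = b) ?subrr ?mul0r ?min_r//.
  by apply/EFin_inj; rewrite trunc_distE// min_r.
- apply: (@lipschitz_unif_continuous _ (b - a)^-1) => x y.
  (* Taking the minimum with 1 does not increase differences. *)
  have H u v : Num.min 1 u - Num.min 1 v <= `|u - v| :> R.
    have := ler_norm (u - v); have := normr_ge0 (u - v).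
    by rewrite !minEle; case: ifPn; case: ifPn; rewrite -?ltNge => *; lra.
  apply: (@le_trans _ _ `|(b - trunc_dist E b x) / (b - a) - (b - trunc_dist E b y) / (b - a)|).
    by rewrite ler_norml H andbT lerNl opprB distrC H.
  rewrite -mulrBl normrM mulrC (@ger0_norm _ (b - a)^-1) ?invr_ge0 ?(ltW ba)//.
  rewrite ler_wpM2l ?invr_ge0 ?(ltW ba)// opprB addrCA addrAC subrr add0r.
  by rewrite distrC trunc_dist_lipschitz.
Qed.

End MetricSets.

(** * Sets and test functions bounded away from [CC] *)

Section AwayFrom.
Variables (R : realType) (S : metricType R) (CC : set S).
Implicit Types (A F G : set S) (r e : R) (f : S -> R).

(** The weak inequality makes this set closed, whereas the complement of [enlargement CC r] is open.
    It can thus serve as a closed level set carrying the support of a test function. *)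
Definition off r : set S := [set x | (r%:E <= dist_set CC x)%E].

Lemma closed_off r : closed (off r).
Proof.
rewrite (_ : off r = ~` [set x | (dist_set CC x < r%:E)%E]).
  exact/open_closedC/open_dist_set_lt.
by apply/seteqP; split => x /=; rewrite /off/= leNgt => /negP.
Qed.

Lemma bounded_awayP A :
  bounded_away A CC <-> exists2 r, 0 < r & A `<=` off r.
Proof.
split.
- move=> AC.
  (* The infimum is infinite when one of the two sets is empty; any radius then works, here 1. *)
  have [r r0 rA] : exists2 r, 0 < r & (r%:E <=
      ereal_inf [set (mdist x.1 x.2)%:E | x in A `*` CC])%E.
    move: AC; rewrite /bounded_away; case: ereal_inf => [s|_|//].
      by rewrite lte_fin => s0; exists s.
    by exists 1 => //; exact: leey.
  exists r => // x Ax; apply: le_ereal_inf_tmp => _ [y Cy <-].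
  by rewrite (le_trans rA)// metric_sym; apply: ereal_inf_lbound; exists (x, y).
- move=> [r r0 Ar]; apply: (@lt_le_trans _ _ r%:E); first by rewrite lte_fin.
  apply: le_ereal_inf_tmp => _ [[x y] [/= Ax Cy] <-].
  apply: le_trans (Ar _ Ax) _; rewrite metric_sym.
  by apply: ereal_inf_lbound; exists y.
Qed.

Lemma off_near A r e x : A `<=` off r -> (dist_set A x < e%:E)%E -> off (r - e) x.
Proof.
move=> Ar /ereal_inf_lt[_ [y /Ar Cy <-]] yx.
rewrite /off/= EFinB leeBlDr//; apply: le_trans Cy _.
by apply: le_trans (dist_set_le _ _ x) _; rewrite metric_sym leeD2l// ltW// metric_sym.
Qed.

Lemma enlargement_off A r b : b < r -> A `<=` off r ->
  enlargement A b `<=` off ((r - b) / 2).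
Proof.
(* An enlargement is given by a weak inequality while [off_near] asks for a strict one, so the
   midpoint of [b] and [r] is used as radius. *)
move=> br Ar x xb; rewrite (_ : (r - b) / 2 = r - (r + b) / 2); last by field.
apply: off_near Ar _; apply: (le_lt_trans xb).
by rewrite lte_fin; lra.
Qed.

Lemma shrinkage_sub A b : 0 <= b -> shrinkage A b `<=` A.
Proof.
move=> b0 x xb; apply: contrapT => nAx; apply: xb.
by rewrite /enlargement/= dist_set_eq0// lee_fin.
Qed.

(** Near a point at distance less than [r] from [CC] the function vanishes identically. Any other
    point has a neighbourhood disjoint from [CC], where continuity within the complement of [CC] is
    ordinary continuity. *)
Lemma test_fun_continuous f : test_fun CC f -> continuous f.
Proof.
move=> [f0 _ /subspace_continuousP fc [r r0 fr]] x.
have [xr|xr] := ltP (dist_set CC x) r%:E.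
  have near0 : \forall y \near x, f y = 0.
    have := open_dist_set_lt CC r; rewrite openE => /(_ x xr).
    by apply: filterS => y /ltW /fr.
  apply/cvgrPdist_lt => e e0; near=> y.
  rewrite (_ : f y = 0); last by near: y.
  by rewrite (nbhs_singleton near0) subrr normr0.
have near_out : \forall y \near x, (~` CC) y.
  have : open (~` enlargement CC (r / 2)) by exact/closed_openC/closed_enlargement.
  rewrite openE => /(_ x) H; have {}H : nbhs x (~` enlargement CC (r / 2)).
    apply: H; apply/negP; rewrite -ltNge; apply: lt_le_trans xr.
    by rewrite lte_fin ltr_pdivrMr// ltr_pMr// ltr1n.
  apply: filterS H => y; apply: contra_not => Cy.
  by rewrite /enlargement/= dist_set_eq0// lee_fin divr_ge0// ltW.
have /= := fc x (nbhs_singleton near_out).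
apply: cvg_trans; apply: cvg_app => A; rewrite /within/= => AC.
apply: filterS (filterI near_out AC) => y [Cy]; exact.
Unshelve. all: by end_near. Qed.

Lemma test_fun_off f : test_fun CC f -> exists M r,
  [/\ 0 < M, 0 < r, forall x, 0 <= f x <= M & forall x, f x != 0 -> off r x].
Proof.
(* The maximum with 1 makes the bound positive, so that it can be divided by later. *)
move=> [f0 [M fM] _ [r r0 fr]]; exists (Num.max M 1), r; split => //.
- by rewrite lt_max ltr01 orbT.
- by move=> x; rewrite f0 le_max fM.
- move=> x; apply: contraPP; rewrite /off/= => /negP; rewrite -ltNge => /ltW /fr ->.
  by apply/negP; rewrite negbK.
Qed.

Lemma off_test_fun f M r : 0 < r -> (forall x, 0 <= f x <= M) -> continuous f ->
  (forall x, f x != 0 -> off r x) -> test_fun CC f.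
Proof.
move=> r0 f0M fc fr; split.
- by move=> x; case/andP: (f0M x).
- by exists M => x; case/andP: (f0M x).
- exact: continuous_subspaceT.
(* At distance exactly [r] the function may be nonzero, so it is only known to vanish on
   enlargements of smaller radius. *)
- exists (r / 2); first by rewrite divr_gt0.
  move=> x; rewrite /enlargement/= => xr; apply/eqP; apply: contraTT xr => /fr.
  rewrite -ltNge; apply: lt_le_trans; rewrite lte_fin.
  by rewrite ltr_pdivrMr// ltr_pMr// ltr1n.
Qed.

(** The integral of this cutoff lies between the measures of the two enlargements of [A]; [b < r]
    keeps its support away from [CC]. *)
Lemma test_fun_outer A r a b : 0 <= a -> a < b -> b < r -> A `<=` off r ->
  exists g : S -> R, [/\ test_fun CC g, unif_continuous g,
    forall x, 0 <= g x <= 1,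
    forall x, enlargement A a x -> g x = 1 &
    forall x, g x != 0 -> enlargement A b x].
Proof.
move=> a0 ab br Ar; have [g [g01 g1 g0 gu]] := urysohn_dist A a0 ab.
have gb x : g x != 0 -> (dist_set A x < b%:E)%E.
  by move=> gx; rewrite ltNge; apply: contra gx => /g0 ->.
exists g; split => //; last by move=> x /gb /ltW.
apply: (@off_test_fun _ 1 (r - b)); rewrite ?subr_gt0//.
  exact: unif_continuous_continuous.
by move=> x /gb; exact: off_near.
Qed.

(** One minus the cutoff in the distance to the complement of [A]. Its support lies inside [A],
    hence away from [CC]. *)
Lemma test_fun_inner A r a b : 0 <= a -> a < b -> 0 < r -> A `<=` off r ->
  exists g : S -> R, [/\ test_fun CC g, unif_continuous g,
    forall x, 0 <= g x <= 1,
    forall x, shrinkage A b x -> g x = 1 &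
    forall x, g x != 0 -> shrinkage A a x].
Proof.
move=> a0 ab r0 Ar; have [g [g01 g1 g0 gu]] := urysohn_dist (~` A) a0 ab.
have ga x : 1 - g x != 0 -> shrinkage A a x.
  by move=> gx /g1 gx1; move: gx; rewrite gx1 subrr eqxx.
have gu' : unif_continuous (fun x => 1 - g x).
  apply/unif_continuousP => e e0; move/unif_continuousP : gu => /(_ e e0)[d d0 gd].
  exists d => // -[x y] /gd /=; rewrite -!ball_normE/=.
  by rewrite distrC (_ : 1 - g x - (1 - g y) = g y - g x); last lra.
exists (fun x => 1 - g x); split => //.
- apply: (@off_test_fun _ 1 r) => //.
  + by move=> x; have /andP[? ?] := g01 x; rewrite subr_ge0 lerBlDr lerDl; apply/andP.
  + exact: unif_continuous_continuous.
  + move=> x /ga xa; apply: Ar; apply: contrapT => nAx; apply: xa.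
    by rewrite /enlargement/= dist_set_eq0// lee_fin.
- by move=> x; have /andP[? ?] := g01 x; rewrite subr_ge0 lerBlDr lerDl; apply/andP.
- move=> x /negP; rewrite -ltNge => /ltW /g0 ->; exact: subr0.
Qed.

End AwayFrom.

(** * Borel measurability, and integrals compared with measures of level sets *)

Section BorelMetric.
Variables (R : realType) (S : completeMetricType R).
Implicit Types (A F G : set S) (r e : R) (f : S -> R).

Lemma borel_open A : open A -> measurable (A : set (borel S)).
Proof. exact: sub_sigma_algebra. Qed.

Lemma borel_closed A : closed A -> measurable (A : set (borel S)).
Proof. by move=> /closed_openC/borel_open/measurableC; rewrite setCK. Qed.

Lemma borel_enlargement A b : measurable (enlargement A b : set (borel S)).
Proof. by apply: borel_closed; exact: closed_enlargement. Qed.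

Lemma borel_shrinkage A b : measurable (shrinkage A b : set (borel S)).
Proof. by apply: borel_open; apply: closed_openC; exact: closed_enlargement. Qed.

Lemma borel_continuous f : continuous f ->
  measurable_fun [set: borel S] (f : borel S -> R).
Proof.
move=> fc; apply: (measurability _ (RGenOpens.measurableE R)).
move=> _ /= [_ [a [b ->]] <-]; rewrite setTI; apply: borel_open.
by apply: open_comp => // x _; exact: fc.
Qed.

Variable nu : {measure set (borel S) -> \bar R}.

Lemma measure_le_integral f A : measurable (A : set (borel S)) -> continuous f ->
  (forall x, 0 <= f x) -> (forall x, A x -> f x = 1) ->
  (nu A <= \int[nu]_x (f x)%:E)%E.
Proof.
move=> mA fc f0 f1; have -> : nu A = (\int[nu]_x (\1_(A : set (borel S)) x)%:E)%E.
  by rewrite integral_indic// setIT.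
apply: ge0_le_integral => //.
- by apply/measurable_EFinP; exact: measurable_indic.
- by apply/measurable_EFinP; exact: borel_continuous.
- move=> x _; rewrite lee_fin indicE; case: (boolP (x \in A)) => //.
  by rewrite inE => /f1 ->.
Qed.

Lemma integral_le_measure f A : measurable (A : set (borel S)) -> continuous f ->
  (forall x, 0 <= f x <= 1) -> (forall x, f x != 0 -> A x) ->
  (\int[nu]_x (f x)%:E <= nu A)%E.
Proof.
move=> mA fc f01 fA; have -> : nu A = (\int[nu]_x (\1_(A : set (borel S)) x)%:E)%E.
  by rewrite integral_indic// setIT.
apply: ge0_le_integral => //.
- by move=> x _; rewrite lee_fin; case/andP: (f01 x).
- by apply/measurable_EFinP; exact: borel_continuous.
- by apply/measurable_EFinP; exact: measurable_indic.
- move=> x _; rewrite lee_fin indicE; have /andP[f0 f1] := f01 x.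
  have [/fA Ax|/negbNE/eqP ->] := boolP (f x != 0); last by rewrite ler0n.
  by rewrite mem_set.
Qed.

Lemma integral_step (s : R) (N : nat) (A : nat -> set S) : 0 <= s ->
  (forall k, measurable (A k : set (borel S))) ->
  (\int[nu]_x (\sum_(k < N) s * \1_(A k) x)%:E = s%:E * \sum_(k < N) nu (A k))%E.
Proof.
move=> s0 mA; under eq_integral do rewrite -sumEFin.
rewrite ge0_integral_sum//.
- rewrite ge0_sume_distrr//; apply: eq_bigr => k _.
  under eq_integral do rewrite EFinM.
  rewrite ge0_integralZl_EFin//.
  + by rewrite integral_indic// setIT.
  + by apply/measurable_EFinP; exact: measurable_indic.
- by move=> k; apply/measurable_EFinP; apply: measurable_funM => //; exact: measurable_indic.
- by move=> k x _; rewrite lee_fin mulr_ge0.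
Qed.

(** If [k] is the last index with [x] in [A k], then [x] lies in at most [k.+1] of the sets counted,
    and [f x] is at least [s * k.+1%:R]. *)
Lemma layer_le_integral f s N (A : nat -> set S) : 0 <= s -> continuous f ->
  (forall x, 0 <= f x) ->
  (forall k, measurable (A k : set (borel S))) ->
  (forall k x, A k x -> s * k.+1%:R <= f x) ->
  (s%:E * \sum_(k < N) nu (A k) <= \int[nu]_x (f x)%:E)%E.
Proof.
move=> s0 fc f0 mA Af; rewrite -integral_step//.
apply: ge0_le_integral => //.
- by move=> x _; rewrite lee_fin sumr_ge0// => k _; rewrite mulr_ge0.
- apply/measurable_EFinP; apply: measurable_sum => k.
  by apply: measurable_funM => //; exact: measurable_indic.
- by apply/measurable_EFinP; exact: borel_continuous.
- move=> x _; rewrite lee_fin.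
  (* The second bound strengthens the induction: when [x] lies in [A n], the first [n] terms
     contribute at most [s * n%:R], which leaves room for one more [s] below [f x]. *)
  suff [] : \sum_(k < N) s * \1_(A k) x <= f x
    /\ \sum_(k < N) s * \1_(A k) x <= s * N%:R :> R by [].
  elim: N => [|n [IH IHn]]; first by rewrite big_ord0 f0 mulr0 lexx.
  rewrite big_ord_recr/= indicE -natr1 mulrDr mulr1.
  have [/set_mem Ax|_] := boolP (x \in A n); last first.
    by rewrite mulr0 addr0 IH; split => //; rewrite (le_trans IHn)// lerDl.
  rewrite mulr1 lerD2r IHn; split => //.
  by apply: le_trans (Af _ _ Ax); rewrite -natr1 mulrDr mulr1 lerD2r.
Qed.

(* [A 0] absorbs the layer [0 < f <= s] that the level sets miss. *)
Lemma integral_le_layer f s N (A : nat -> set S) : 0 <= s -> continuous f ->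
  (forall x, 0 <= f x <= s * N%:R) ->
  (forall k, measurable (A k : set (borel S))) ->
  (forall x, f x != 0 -> A 0%N x) ->
  (forall k x, s * k%:R < f x -> A k x) ->
  (\int[nu]_x (f x)%:E <= s%:E * \sum_(k < N.+1) nu (A k))%E.
Proof.
move=> s0 fc f0 mA fA Af; rewrite -integral_step//.
apply: ge0_le_integral => //.
- by move=> x _; rewrite lee_fin; case/andP: (f0 x).
- by apply/measurable_EFinP; exact: borel_continuous.
- apply/measurable_EFinP; apply: measurable_sum => k.
  by apply: measurable_funM => //; exact: measurable_indic.
- move=> x _; rewrite lee_fin; have /andP[fx0 fxN] := f0 x.
  (* Passing from [n] to [n.+1] raises this minimum by at most [s], and not at all if
     [f x <= s * n%:R], which is the case whenever [x] is outside [A n]. *)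
  suff H n : Num.min (f x) (s * n%:R) <= \sum_(k < n) s * \1_(A k) x.
    apply: le_trans (H _); rewrite le_min lexx/=.
    by rewrite (le_trans fxN)// ler_wpM2l// ler_nat.
  elim: n => [|n IH]; first by rewrite big_ord0 mulr0 ge_min lexx orbT.
  rewrite big_ord_recr/= indicE -natr1 mulrDr mulr1.
  have [_|/negP Ax] := boolP (x \in A n).
    apply: le_trans (lerD IH (lexx _)); rewrite mulr1.
    by rewrite !minEle; do 2 case: ifPn; rewrite -?ltNge => *; lra.
  rewrite mulr0 addr0; apply: le_trans IH.
  rewrite ge_min le_min lexx/=; apply/orP; left.
  by rewrite leNgt; apply/negP => /Af /mem_set.
Qed.

End BorelMetric.

(** * Measures finite away from [CC], and convergence of integrals from bounds on sets *)

Section OffMeasure.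
Variables (R : realType) (S : completeMetricType R) (CC : set S).
Implicit Types (A F G : set S) (r e : R) (f : S -> R).
Implicit Types nu : {measure set (borel S) -> \bar R}.

Lemma off_measure_fin nu r A : off_measure CC nu -> 0 < r ->
  measurable (A : set (borel S)) -> A `<=` off CC r -> nu A \is a fin_num.
Proof.
move=> [_ nufin] r0 mA Ar; rewrite ge0_fin_numE//.
have r20 : 0 < r / 2 by rewrite divr_gt0.
apply: le_lt_trans (nufin _ r20); apply: le_measure; rewrite ?inE//.
  by apply: borel_open; apply: closed_openC; exact: closed_enlargement.
move=> x /Ar; rewrite /off/enlargement/= => rx; apply/negP.
rewrite -ltNge (lt_le_trans _ rx)// lte_fin.
by rewrite ltr_pdivrMr// ltr_pMr// ltr1n.
Qed.

Lemma pairing_ge0 nu f : (forall x, 0 <= f x) -> (0 <= pairing nu f)%E.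
Proof. by move=> f0; apply: integral_ge0 => x _; rewrite lee_fin. Qed.

Lemma pairing_fin nu f : off_measure CC nu -> test_fun CC f ->
  pairing nu f \is a fin_num.
Proof.
move=> nuC tf; have fc := test_fun_continuous tf.
have [M [r [M0 r0 f0M fr]]] := test_fun_off tf.
have f0 x : 0 <= f x by case/andP: (f0M x).
rewrite ge0_fin_numE ?pairing_ge0//.
have mH : measurable (off CC r : set (borel S)) by apply: borel_closed; exact: closed_off.
(* A crude layer bound with the single thickness [M] and the support set [off CC r] as every
   layer. *)
apply: (@le_lt_trans _ _ (M%:E * \sum_(k < 2) nu (off CC r))%E).
  apply: (@integral_le_layer _ _ nu f M 1 (fun=> off CC r)) => //.
  - exact: ltW.
  - by move=> x; rewrite mulr1.
  - move=> k x kx; apply: fr; rewrite gt_eqF// (le_lt_trans _ kx)//.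
    by rewrite mulr_ge0// ltW.
have /fineK <- := off_measure_fin nuC r0 mH (fun x H => H).
by rewrite sumEFin -EFinM ltry.
Qed.

(** Layers of thickness [s] compare both integrals with sums of measures of level sets: open ones
    for the lower bound on [nu_ k], closed ones for the upper bound. Upper and lower layer sums
    differ by one bottom layer, of size at most [s * C]. *)
Lemma portmanteau_sets (nu_ : nat -> {measure set (borel S) -> \bar R}) nu :
  (forall k, off_measure CC (nu_ k)) -> off_measure CC nu ->
  (forall F r e, closed F -> 0 < r -> F `<=` off CC r -> 0 < e ->
     \forall k \near \oo, fine (nu_ k F) <= fine (nu F) + e) ->
  (forall G r e, open G -> 0 < r -> G `<=` off CC r -> 0 < e ->
     \forall k \near \oo, fine (nu G) - e <= fine (nu_ k G)) ->
  forall f, test_fun CC f -> pairing (nu_ k) f @[k --> \oo] --> pairing nu f.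
Proof.
move=> offk offn hF hG f tf; have fc := test_fun_continuous tf.
have [M [r [M0 r0 f0M fr]]] := test_fun_off tf.
have f0 x : 0 <= f x by case/andP: (f0M x).
have Hfin m : off_measure CC m -> m (off CC r) \is a fin_num.
  by move=> mC; apply: (off_measure_fin mC r0) => //; apply: borel_closed; exact: closed_off.
have /fineK <- := pairing_fin offn tf.
apply/fine_cvgP; split; first by apply: nearW => k; exact: pairing_fin.
apply/cvgrPdist_le => e e0.
set C := fine (nu (off CC r)).
have C0 : 0 <= C by rewrite fine_ge0.
(* The thickness divides [M] evenly and makes the bottom layer cost at most [e / 2]. Using [C + 1]
   avoids dividing by zero. *)
have [s [N [s0 sN sC]]] : exists s N, [/\ 0 < s, s * N.+1%:R = M & s * C <= e / 2].
  have MC0 : 0 < M * (C + 1) by rewrite mulr_gt0// ltr_wpDl.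
  have /ltr_add_invr[N] : 0 < e / 2 / (M * (C + 1)) by rewrite !divr_gt0.
  rewrite add0r ltr_pdivlMr// mulrC => hN.
  exists (M / N.+1%:R), N; split; rewrite ?divr_gt0 ?divfK//.
  apply: le_trans (ltW hN); rewrite mulrAC ler_wpM2r ?invr_ge0//.
  by rewrite ler_wpM2l ?(ltW M0)// lerDl.
(* Intersecting with [off CC r] matters at [k = 0], where the level set is the whole space. The open
   sets [B] start one level higher, at [s], and so lie in [off CC r] by themselves. *)
set A := fun k : nat => off CC r `&` [set x | s * k%:R <= f x].
set B := fun k : nat => [set x | s * k.+1%:R < f x].
have cA k : closed (A k).
  apply: closedI; first exact: closed_off.
  rewrite (_ : mkset _ = f @^-1` [set y | s * k%:R <= y])//.
  by apply: closed_comp; [move=> x _; exact: fc|exact: closed_ge].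
have oB k : open (B k).
  rewrite (_ : B k = f @^-1` [set y | s * k.+1%:R < y])//.
  by apply: open_comp; [move=> x _; exact: fc|exact: open_gt].
have Asub k : A k `<=` off CC r by move=> x [].
have Bsub k : B k `<=` off CC r.
  move=> x /= Bx; apply: fr; rewrite gt_eqF// (le_lt_trans _ Bx)//.
  by rewrite mulr_ge0// ltW.
have mA k : measurable (A k : set (borel S)) by exact: borel_closed.
have mB k : measurable (B k : set (borel S)) by exact: borel_open.
have f0N x : 0 <= f x <= s * N.+1%:R by rewrite sN.
have fin_layers m (D : nat -> set S) n : off_measure CC m -> (forall k, measurable (D k : set (borel S))) ->
    (forall k, D k `<=` off CC r) ->
    (s%:E * \sum_(k < n) m (D k))%E = (s * \sum_(k < n) fine (m (D k)))%:E.
  move=> mC mD Dr; rewrite EFinM EFin_sum_fine// => k _.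
  exact: off_measure_fin mC r0 (mD k) (@Dr k).
have up m (D : nat -> set S) : off_measure CC m -> (forall k, measurable (D k : set (borel S))) ->
    (forall k, D k `<=` off CC r) -> (forall x, f x != 0 -> D 0%N x) ->
    (forall k x, s * k%:R < f x -> D k x) ->
    fine (pairing m f) <= s * \sum_(k < N.+2) fine (m (D k)).
  move=> mC mD Dr fD0 fD; rewrite -lee_fin fineK ?pairing_fin// -fin_layers//.
  exact: (integral_le_layer m (ltW s0) fc f0N mD).
have lo m (D : nat -> set S) : off_measure CC m -> (forall k, measurable (D k : set (borel S))) ->
    (forall k, D k `<=` off CC r) ->
    (forall k x, D k x -> s * k.+1%:R <= f x) ->
    s * \sum_(k < N.+1) fine (m (D k)) <= fine (pairing m f).
  move=> mC mD Dr fD; rewrite -lee_fin fineK ?pairing_fin// -fin_layers//.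
  exact: layer_le_integral (ltW s0) fc f0 mD fD.
(* An error [d] on each of [N.+1] sets, weighted by [s], adds up to [M * d = e / 4]; the additional
   set in the upper bound costs at most another [e / 4]. *)
set d := e / (4 * M).
have d0 : 0 < d by rewrite divr_gt0// mulr_gt0.
have Md : M * d = e / 4 by rewrite /d; field; rewrite gt_eqF.
have sNd : s * (d *+ N.+1) = e / 4 by rewrite -mulr_natr mulrCA sN mulrC.
have sd : s * d <= e / 4.
  rewrite -sNd ler_wpM2l ?(ltW s0)// -[leLHS]mulr1n.
  by rewrite ler_wpMn2l// ltW.
near=> k; rewrite /= ler_distlC; apply/andP; split.
- have H1 : forall j : 'I_N.+1, fine (nu (B j)) - d <= fine (nu_ k (B j)).
    by near: k; apply: filter_forall => j; exact: hG (oB j) r0 (@Bsub j) d0.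
  (* The open layers shifted by one, with [off CC r] at the bottom, give an upper sum for [nu] from
     the same sets [B] as the lower sum for [nu_ k]. The bottom costs [s * C]. *)
  pose D j := if j is j'.+1 then B j' else off CC r.
  have mD j : measurable (D j : set (borel S)).
    by case: j => [|j]; [apply: borel_closed; exact: closed_off|exact: mB].
  have Dr j : D j `<=` off CC r by case: j => [|j]; [|exact: Bsub].
  have fD j x : s * j%:R < f x -> D j x.
    by case: j => [|j]//; rewrite mulr0 => fx; apply: fr; rewrite gt_eqF.
  have := up nu D offn mD Dr fr fD; rewrite big_ord_recl /= -/C.
  have := lo (nu_ k) B (offk k) mB Bsub (fun k x => @ltW _ _ _ _).
  have : s * \sum_(j < N.+1) (fine (nu (B j)) - d) <=
      s * \sum_(j < N.+1) fine (nu_ k (B j)).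
    by rewrite ler_pM2l//; apply: ler_sum => j _; exact: H1.
  rewrite sumrB sumr_const card_ord mulrBr sNd mulrDr.
  by move=> h1 h2 h3; lra.
- have H1 : forall j : 'I_N.+2, fine (nu_ k (A j)) <= fine (nu (A j)) + d.
    by near: k; apply: filter_forall => j; exact: hF (cA j) r0 (@Asub j) d0.
  have A0 x : f x != 0 -> A 0%N x by move=> /fr ?; split => //=; rewrite mulr0.
  have fA j x : s * j%:R < f x -> A j x.
    move=> jx; split; last exact: ltW.
    by apply: fr; rewrite gt_eqF// (le_lt_trans _ jx)// mulr_ge0// ltW.
  have := up (nu_ k) A (offk k) mA Asub A0 fA.
  (* Dropping [A 0] turns the closed layers into a lower sum for [nu]; the dropped layer costs at
     most [s * C]. *)
  have := lo nu (fun j => A j.+1) offn (fun j => mA j.+1) (fun j => @Asub j.+1) (fun k x => @proj2 _ _).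
  have : s * \sum_(j < N.+2) fine (nu_ k (A j)) <=
      s * \sum_(j < N.+2) (fine (nu (A j)) + d).
    by rewrite ler_pM2l//; apply: ler_sum => j _; exact: H1.
  have : s * fine (nu (A 0%N)) <= s * C.
    rewrite ler_pM2l// fine_le ?Hfin// ?(off_measure_fin offn r0 (mA 0%N) (@Asub 0%N))//.
    apply: le_measure; rewrite ?inE//.
    by apply: borel_closed; exact: closed_off.
  rewrite big_split/= sumr_const card_ord mulrSr !(mulrDr s) sNd.
  rewrite [\sum_(j < N.+2) fine (nu _)]big_ord_recl mulrDr/=.
  by move=> h1 h2 h3; lra.
Unshelve. all: end_near. Qed.
End OffMeasure.

(** * Approximating closed sets by enlargements and open sets by shrinkages *)

Section Approx.
Variables (R : realType) (S : completeMetricType R) (CC : set S).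
Implicit Types (A F G : set S) (r e : R) (f : S -> R).
Implicit Types nu : {measure set (borel S) -> \bar R}.

Lemma closed_dist_set_gt0 A x : closed A -> ~ A x ->
  exists2 e, 0 < e & (e%:E <= dist_set A x)%E.
Proof.
move=> /closed_openC; rewrite openE => oA /oA /nbhs_ballP[e /= e0 eA].
exists e => //; apply: le_ereal_inf_tmp => _ [y Ay <-]; rewrite lee_fin leNgt.
by apply/negP => yx; apply: (eA y) => //; rewrite ballEmdist/= metric_sym.
Qed.

(** The offset 2 keeps [r / k.+2%:R] strictly below [r] already at [k = 0]. *)
Lemma small_radius r e : 0 < r -> 0 < e -> exists k, r / k.+2%:R < e.
Proof.
move=> r0 e0; have /ltr_add_invr[k] : 0 < e / r by rewrite divr_gt0.
rewrite add0r ltr_pdivlMr// mulrC => kr; exists k.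
apply: le_lt_trans kr; rewrite ler_pM2l// lef_pV2 ?posrE ?ltr0n// ler_nat.
exact: leqnSn.
Qed.

Lemma le_radius r (m n : nat) : 0 < r -> (m <= n)%N -> r / n.+2%:R <= r / m.+2%:R.
Proof. by move=> r0 mn; rewrite ler_pM2l// lef_pV2 ?posrE ?ltr0n// ler_nat. Qed.

(** Continuity from above: the enlargements decrease to [F] because [F] is closed, and the first one
    has finite measure because it stays away from [CC]. *)
Lemma closed_approx nu F r e : off_measure CC nu -> closed F -> 0 < r ->
  F `<=` off CC r -> 0 < e ->
  exists b, [/\ 0 < b, b < r & fine (nu (enlargement F b)) <= fine (nu F) + e].
Proof.
move=> nuC cF r0 Fr e0; pose E n := enlargement F (r / n.+2%:R).
have mE n : measurable (E n : set (borel S)).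
  exact: borel_enlargement.
have b1 n : r / n.+2%:R < r by rewrite ltr_pdivrMr// ltr_pMr// ltr1n.
have Eoff n : E n `<=` off CC (r - (r / n.+2%:R + r) / 2).
  move=> x En; apply: off_near Fr _; apply: (le_lt_trans En).
  by rewrite lte_fin; move: (r / n.+2%:R) (b1 n) => c cr; lra.
have Efin n : nu (E n) \is a fin_num.
  by apply: off_measure_fin nuC _ (mE n) (@Eoff n); rewrite subr_gt0; move: (r / n.+2%:R) (b1 n) => c cr; lra.
have EF : \bigcap_n E n = F.
  apply/seteqP; split => [x Ex|x Fx n _]; last first.
    by rewrite /E/enlargement/= dist_set_eq0// lee_fin divr_ge0// ltW.
  apply: contrapT => /(closed_dist_set_gt0 cF)[d d0 dx].
  have [k kd] := small_radius r0 d0.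
  by have := le_trans dx (Ex k I); rewrite lee_fin leNgt kd.
have mF : measurable (F : set (borel S)) by exact: borel_closed.
have Ecvg : nu (E n) @[n --> \oo] --> nu F.
  rewrite -[in X in _ --> X]EF; apply: nonincreasing_cvg_mu => //.
  - by rewrite -ge0_fin_numE.
  - by rewrite EF.
  - move=> m n mn; apply/subsetPset => x; rewrite /E/enlargement/= => /le_trans; apply.
    by rewrite lee_fin le_radius.
have /fineK Ffin : nu F \is a fin_num by exact: off_measure_fin nuC r0 mF Fr.
move: Ecvg; rewrite -Ffin => /fine_cvg /cvgr_le H.
have [|n _ /(_ n (leqnn n)) /= Hn] := H (fine (nu F) + e); first by rewrite ltrDl.
by exists (r / n.+2%:R); split; rewrite ?divr_gt0.
Qed.

(** Continuity from below: the shrinkages increase to [G] because every point of an open set has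
    positive distance to its complement. *)
Lemma open_approx nu G r e : off_measure CC nu -> open G -> 0 < r ->
  G `<=` off CC r -> 0 < e ->
  exists2 b, 0 < b & fine (nu G) - e <= fine (nu (shrinkage G b)).
Proof.
move=> nuC oG r0 Gr e0; pose E n := shrinkage G (1 / n.+2%:R).
have mE n : measurable (E n : set (borel S)).
  exact: borel_shrinkage.
have EG : \bigcup_n E n = G.
  apply/seteqP; split => [x [n _ Ex]|x Gx].
    apply: contrapT => nGx; apply: Ex.
    by rewrite /enlargement/= dist_set_eq0// lee_fin divr_ge0.
  have [d d0 dx] : exists2 d, 0 < d & (d%:E <= dist_set (~` G) x)%E.
    by apply: closed_dist_set_gt0; [exact: open_closedC|exact].
  have [k kd] := small_radius ltr01 d0.
  exists k => //; rewrite /E/shrinkage/enlargement/=; apply/negP.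
  by rewrite -ltNge; apply: lt_le_trans dx; rewrite lte_fin.
have mG : measurable (G : set (borel S)) by exact: borel_open.
have Ecvg : nu (E n) @[n --> \oo] --> nu G.
  rewrite -[in X in _ --> X]EG; apply: nondecreasing_cvg_mu => //.
  - by rewrite EG.
  - move=> m n mn; apply/subsetPset => x; rewrite /E/shrinkage/enlargement/= => h1 h2.
    by apply: h1; apply: (le_trans h2); rewrite lee_fin le_radius.
have /fineK Gfin : nu G \is a fin_num by exact: off_measure_fin nuC r0 mG Gr.
move: Ecvg; rewrite -Gfin => /fine_cvg /cvgr_ge H.
have [|n _ /(_ n (leqnn n)) /= Hn] := H (fine (nu G) - e); first by rewrite ltrBlDr ltrDl.
by exists (1 / n.+2%:R); rewrite ?divr_gt0.
Qed.

End Approx.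

(** * Upper and lower limits in terms of eventual bounds *)

Section LimfNear.
Variable R : realType.
Implicit Types (F : set_system R) (u : R -> \bar R) (c : \bar R).

Lemma limf_esup_le_near F u c :
  (forall e, 0 < e -> \forall x \near F, (u x <= c + e%:E)%E) -> (limf_esup u F <= c)%E.
Proof.
move=> uc; apply/lee_addgt0Pr => e e0; rewrite limf_esupE.
apply: ge_ereal_inf; exists (ereal_sup (u @` [set x | (u x <= c + e%:E)%E])).
  by exists [set x | (u x <= c + e%:E)%E] => //; exact: uc.
by apply: ge_ereal_sup => _ [x /= xc <-].
Qed.

Lemma limf_esup_near_lt F u c : Filter F -> (limf_esup u F < c)%E -> \forall x \near F, (u x < c)%E.
Proof.
move=> FF; rewrite limf_esupE => /ereal_inf_lt[_ [V FV <-]] Vc.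
apply: filterS FV => x Vx; apply: le_lt_trans Vc.
by apply: ereal_sup_ubound; exists x.
Qed.

Lemma limf_einf_ge_near F u c :
  (forall e, 0 < e -> \forall x \near F, (c - e%:E <= u x)%E) -> (c <= limf_einf u F)%E.
Proof.
move=> uc; apply/lee_subgt0Pr => e e0; rewrite limf_einfE.
apply: le_ereal_sup_tmp; exists (ereal_inf (u @` [set x | (c - e%:E <= u x)%E])).
  by exists [set x | (c - e%:E <= u x)%E] => //; exact: uc.
by apply: le_ereal_inf_tmp => _ [x /= xc <-].
Qed.

Lemma limf_einf_near_gt F u c : Filter F -> (c < limf_einf u F)%E -> \forall x \near F, (c < u x)%E.
Proof.
move=> FF; rewrite limf_einfE => /ereal_sup_gt[_ [V FV <-]] Vc.
apply: filterS FV => x Vx; apply: (lt_le_trans Vc).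
by apply: ereal_inf_lbound; exists x.
Qed.

End LimfNear.

(** * Uniform convergence in the parameter and its reduction to sequences *)

Section Uniform.
Variables (R : realType) (S : completeMetricType R) (CC : set S) (Theta : Type).
Variables (mueta : R -> Theta -> {measure set (borel S) -> \bar R}).
Variables (mu : Theta -> {measure set (borel S) -> \bar R}).

Lemma unif_gap_cvgP (f : S -> R) :
  unif_gap mueta mu f eta @[eta --> 0^'+] --> 0%E <->
  forall e, 0 < e -> \forall eta \near 0^'+, forall theta,
    (`|pairing (mueta eta theta) f - pairing (mu theta) f| <= e%:E)%E.
Proof.
have gap0 eta : (0 <= unif_gap mueta mu f eta)%E by rewrite /unif_gap le_max lexx.
split=> [/fine_cvgP[gapfin /cvgr_le gapc] e e0|gape].
  near=> eta => theta; apply: (@le_trans _ _ (unif_gap mueta mu f eta)).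
    rewrite /unif_gap le_max; apply/orP; right.
    by apply: ereal_sup_ubound; exists theta.
  have /fineK <- : unif_gap mueta mu f eta \is a fin_num by near: eta.
  by rewrite lee_fin; near: eta; exact: gapc.
have gap_le e : 0 < e -> \forall eta \near 0^'+, (unif_gap mueta mu f eta <= e%:E)%E.
  move=> e0; near=> eta; rewrite /unif_gap ge_max lee_fin (ltW e0)/=.
  by apply: ge_ereal_sup => _ [theta _ <-]; move: theta; near: eta; exact: gape.
have gap_fin eta e : (unif_gap mueta mu f eta <= e%:E)%E -> unif_gap mueta mu f eta \is a fin_num.
  by move=> h; rewrite ge0_fin_numE// (le_lt_trans h) ?ltry.
apply/fine_cvgP; split.
  (* Any finite bound would do to make the gap eventually finite; 1 is taken. *)
  by near=> eta; apply: (gap_fin eta 1); near: eta; exact: gap_le.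
apply/cvgrPdist_le => e e0; near=> eta.
have h : (unif_gap mueta mu f eta <= e%:E)%E by near: eta; exact: gap_le.
rewrite sub0r normrN ger0_norm/= ?fine_ge0//.
by rewrite -lee_fin fineK ?(gap_fin _ _ h).
Unshelve. all: by end_near. Qed.

Hypothesis hseq : forall t : nat -> Theta,
  exists (n_ : nat -> nat) (tstar : Theta),
    increasing_seq n_ /\
    forall f, test_fun CC f ->
      pairing (mu (t (n_ k))) f @[k --> \oo] --> pairing (mu tstar) f.

(* Otherwise counterexamples [(u k, t k)] with [u k < 1/(k+1)] can be chosen; pass to
   a subsequence along which [mu (t k)] converges. *)
Lemma near_unif_of_seq (P : R -> Theta -> Prop) :
  (forall (u : nat -> R) (t : nat -> Theta) (tstar : Theta),
    (forall k, 0 < u k) -> u k @[k --> \oo] --> 0^'+ ->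
    (forall f, test_fun CC f -> pairing (mu (t k)) f @[k --> \oo] --> pairing (mu tstar) f) ->
    exists k, P (u k) (t k)) ->
  \forall eta \near 0^'+, forall theta, P eta theta.
Proof.
move=> Pseq; apply: contrapT => nP.
have bad n : exists p : R * Theta, 0 < p.1 < n.+1%:R^-1 /\ ~ P p.1 p.2.
  apply: contrapT => nbad; apply: nP; near=> eta => theta.
  apply: contrapT => nPet; apply: nbad; exists (eta, theta); split => //=.
  by apply/andP; split; near: eta; [exact: nbhs_right_gt|exact: nbhs_right_lt].
have [p pP] := choice bad.
have [n_ [tstar [n_inc n_cvg]]] := hseq (fun n => (p n).2).
have n_ge k : (k <= n_ k)%N.
  elim: k => // k IH; apply: leq_ltn_trans IH _.
  (* [increasing_seq] is an equivalence of comparisons; its false instance at [k.+1] and [k] gives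
     strict growth. *)
  by have := n_inc k k.+1; have := n_inc k.+1 k; rewrite ltnn leqnSn /Order.le/= ltnNge => ->.
have := Pseq (fun k => (p (n_ k)).1) (fun k => (p (n_ k)).2) tstar.
case.
- by move=> k; have [/andP[]] := pP (n_ k).
- move=> A [e /= e0 Ae].
  have /ltr_add_invr[N] := e0; rewrite add0r => Ne.
  exists N => // k /= Nk; have [/andP[p0 pk] _] := pP (n_ k).
  apply: Ae => //=; rewrite sub0r normrN gtr0_norm//.
  apply: lt_trans pk (le_lt_trans _ Ne).
  by rewrite lef_pV2 ?posrE ?ltr0n// ler_nat ltnS (leq_trans Nk).
- exact: n_cvg.
- by move=> k; have [_] := pP (n_ k).
Unshelve. all: by end_near. Qed.

End Uniform.

(** * From test functions to sets, and from sets to limits along sequences *)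

Section Equivalence.
Variables (R : realType) (S : completeMetricType R) (CC : set S) (Theta : Type).
Variables (mueta : R -> Theta -> {measure set (borel S) -> \bar R}).
Variables (mu : Theta -> {measure set (borel S) -> \bar R}).
Hypothesis hmueta : forall eta theta, 0 < eta -> off_measure CC (mueta eta theta).
Hypothesis hmu : forall theta, off_measure CC (mu theta).

Definition cvg_on_unif_continuous : Prop := forall f : S -> R, test_fun CC f -> unif_continuous f ->
  unif_gap mueta mu f eta @[eta --> 0^'+] --> 0%E.

Definition set_bounds : Prop := forall (eps : R) (F G : set S), 0 < eps ->
  closed F -> bounded_away F CC -> open G -> bounded_away G CC ->
  (limf_esup (fun eta : R => ereal_sup (range (fun theta =>
      mueta eta theta F - mu theta (enlargement F eps)))) 0%R^'+ <= 0)%E /\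
  (0 <= limf_einf (fun eta : R => ereal_inf (range (fun theta =>
      mueta eta theta G - mu theta (shrinkage G eps)))) 0%R^'+)%E.

Lemma cvg_on_unif_continuous_set_bounds : cvg_on_unif_continuous -> set_bounds.
Proof.
move=> hii eps F G eps0 cF /bounded_awayP[rF rF0 Fr] oG /bounded_awayP[r r0 Gr].
split.
- apply: limf_esup_le_near => e e0; rewrite add0e.
  (* This outer radius is at most [eps], so the cutoff is supported in the enlargement of [F], and
     below [rF], so that it is a test function. *)
  have b0 : 0 < Num.min eps (rF / 2) by rewrite lt_min eps0 divr_gt0.
  have br : Num.min eps (rF / 2) < rF.
    by rewrite gt_min; apply/orP; right; rewrite ltr_pdivrMr// ltr_pMr// ltr1n.
  have [g [tg ug g01 g1 g0]] := test_fun_outer (lexx 0) b0 br Fr.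
  have gc := unif_continuous_continuous ug.
  have g_ge0 x : 0 <= g x by case/andP: (g01 x).
  near=> eta; apply: ge_ereal_sup => _ [theta _ <-].
  have gap : (`|pairing (mueta eta theta) g - pairing (mu theta) g| <= e%:E)%E.
    move: theta; near: eta; exact: (unif_gap_cvgP mueta mu g).1 (hii g tg ug) e e0.
  have h1 : (mueta eta theta F <= pairing (mueta eta theta) g)%E.
    apply: measure_le_integral => //; first exact: borel_closed.
    by move=> x Fx; apply: g1; rewrite /enlargement/= dist_set_eq0.
  have h2 : (pairing (mu theta) g <= mu theta (enlargement F eps))%E.
    apply: integral_le_measure => //; first exact: borel_enlargement.
    move=> x /g0; rewrite /enlargement/= => /le_trans; apply.
    by rewrite lee_fin ge_min lexx.
  apply: le_trans (leeB h1 h2) _; apply: le_trans gap; exact: lee_abs.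
- apply: limf_einf_ge_near => e e0; rewrite add0e.
  have [g [tg ug g01 g1 g0]] := test_fun_inner (lexx 0) eps0 r0 Gr.
  have gc := unif_continuous_continuous ug.
  have g_ge0 x : 0 <= g x by case/andP: (g01 x).
  near=> eta; apply: le_ereal_inf_tmp => _ [theta _ <-].
  have gap : (`|pairing (mueta eta theta) g - pairing (mu theta) g| <= e%:E)%E.
    move: theta; near: eta; exact: (unif_gap_cvgP mueta mu g).1 (hii g tg ug) e e0.
  have h1 : (mu theta (shrinkage G eps) <= pairing (mu theta) g)%E.
    by apply: measure_le_integral => //; exact: borel_shrinkage.
  have h2 : (pairing (mueta eta theta) g <= mueta eta theta G)%E.
    apply: integral_le_measure => //; first exact: borel_open.
    by move=> x /g0; exact: shrinkage_sub.
  apply: le_trans (leeB h2 h1); rewrite leeNl; apply: le_trans gap.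
  by rewrite -abseN; exact: lee_abs.
Unshelve. all: by end_near. Qed.

Variables (u : nat -> R) (t : nat -> Theta) (tstar : Theta).
Hypotheses (u0 : forall k, 0 < u k) (ucvg : u k @[k --> \oo] --> 0^'+).
Hypothesis tcvg : forall f, test_fun CC f ->
  pairing (mu (t k)) f @[k --> \oo] --> pairing (mu tstar) f.

Lemma fine_tcvg f : test_fun CC f ->
  fine (pairing (mu (t k)) f) @[k --> \oo] --> fine (pairing (mu tstar) f).
Proof.
move=> tf; have := tcvg tf.
by rewrite -(fineK (pairing_fin (hmu tstar) tf)) => /fine_cvg.
Qed.

(** With errors [e / 3] from (iii), from the convergence of [mu (t k)] on [g], and from
    [closed_approx], the chain runs from [mueta (u k) (t k) F] through [mu (t k)] of the
    [b / 2]-enlargement, [g] under [mu (t k)], [g] under [mu tstar], and [mu tstar] of the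
    [b]-enlargement to [mu tstar F]. *)
Lemma set_bounds_closed_seq F r e : set_bounds ->
  closed F -> 0 < r -> F `<=` off CC r -> 0 < e ->
  \forall k \near \oo,
    fine (mueta (u k) (t k) F) <= fine (mu tstar F) + e.
Proof.
move=> hiii cF r0 Fr e0.
have e30 : 0 < e / 3 by rewrite divr_gt0.
have [b [b0 br Fb]] := closed_approx (hmu tstar) cF r0 Fr e30.
have b20 : 0 < b / 2 by rewrite divr_gt0.
have b2b : b / 2 < b by rewrite ltr_pdivrMr// ltr_pMr// ltr1n.
have [g [tg ug g01 g1 g0]] := test_fun_outer (ltW b20) b2b br Fr.
have gc := unif_continuous_continuous ug.
have g_ge0 x : 0 <= g x by case/andP: (g01 x).
have b2r := lt_trans b2b br.
have Ffin m a : off_measure CC m -> a < r -> m (enlargement F a) \is a fin_num.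
  move=> mC ar; apply: off_measure_fin mC _ (borel_enlargement _ _) (enlargement_off ar Fr).
  by rewrite divr_gt0// subr_gt0.
(* [set_bounds] treats a closed and an open set together; the empty set fills the open slot. *)
have [hsup _] := hiii (b / 2) F set0 b20 cF ((bounded_awayP CC F).2 (ex_intro2 _ _ r r0 Fr))
  open0 ((bounded_awayP CC set0).2 (ex_intro2 _ _ 1 ltr01 (@sub0set _ _))).
have hnear : \forall eta \near 0^'+, (ereal_sup (range (fun theta =>
      mueta eta theta F - mu theta (enlargement F (b / 2)))) < (e / 3)%:E)%E.
  by apply: limf_esup_near_lt; apply: (le_lt_trans hsup); rewrite lte_fin.
near=> k.
have h1 : (mueta (u k) (t k) F - mu (t k) (enlargement F (b / 2)) < (e / 3)%:E)%E.
  apply: (@le_lt_trans _ _ (ereal_sup (range (fun theta =>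
      mueta (u k) theta F - mu theta (enlargement F (b / 2))))))%E.
    by apply: ereal_sup_ubound; exists (t k).
  by near: k; exact: ucvg hnear.
have h2 : (mu (t k) (enlargement F (b / 2)) <= pairing (mu (t k)) g)%E.
  by apply: measure_le_integral => //; exact: borel_enlargement.
have h3 : (pairing (mu tstar) g <= mu tstar (enlargement F b))%E.
  by apply: integral_le_measure => //; exact: borel_enlargement.
have h4 : fine (pairing (mu (t k)) g) <= fine (pairing (mu tstar) g) + e / 3.
  by near: k; apply: cvgr_le (fine_tcvg tg) _ _; rewrite ltrDl.
have mF : mueta (u k) (t k) F \is a fin_num.
  by apply: off_measure_fin (hmueta _ (u0 k)) r0 _ Fr; exact: borel_closed.
have := fine_le (Ffin _ _ (hmu (t k)) b2r) (pairing_fin (hmu (t k)) tg) h2.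
have := fine_le (pairing_fin (hmu tstar) tg) (Ffin _ _ (hmu tstar) br) h3.
move: h1; rewrite -(fineK mF) -(fineK (Ffin _ _ (hmu (t k)) b2r)) -EFinB lte_fin/=.
move=> h1 h3' h2'; lra.
Unshelve. all: by end_near. Qed.

(** The dual chain: [mu tstar G] is compared with the [b]-shrinkage, then with [g] under [mu tstar]
    and under [mu (t k)], then with the [b / 2]-shrinkage, and finally with
    [mueta (u k) (t k) G]. *)
Lemma set_bounds_open_seq G r e : set_bounds ->
  open G -> 0 < r -> G `<=` off CC r -> 0 < e ->
  \forall k \near \oo,
    fine (mu tstar G) - e <= fine (mueta (u k) (t k) G).
Proof.
move=> hiii oG r0 Gr e0.
have e30 : 0 < e / 3 by rewrite divr_gt0.
have [b b0 Gb] := open_approx (hmu tstar) oG r0 Gr e30.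
have b20 : 0 < b / 2 by rewrite divr_gt0.
have b2b : b / 2 < b by rewrite ltr_pdivrMr// ltr_pMr// ltr1n.
have [g [tg ug g01 g1 g0]] := test_fun_inner (ltW b20) b2b r0 Gr.
have gc := unif_continuous_continuous ug.
have g_ge0 x : 0 <= g x by case/andP: (g01 x).
have Gfin m a : off_measure CC m -> 0 < a -> m (shrinkage G a) \is a fin_num.
  move=> mC a0; apply: off_measure_fin mC r0 (borel_shrinkage _ _) _.
  by apply: subset_trans Gr; exact: shrinkage_sub (ltW a0).
have [_ hinf] := hiii (b / 2) set0 G b20 closed0
  ((bounded_awayP CC set0).2 (ex_intro2 _ _ 1 ltr01 (@sub0set _ _)))
  oG ((bounded_awayP CC G).2 (ex_intro2 _ _ r r0 Gr)).
have hnear : \forall eta \near 0^'+, ((- (e / 3))%:E < ereal_inf (range (fun theta =>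
      mueta eta theta G - mu theta (shrinkage G (b / 2)))))%E.
  by apply: limf_einf_near_gt; apply: lt_le_trans hinf; rewrite lte_fin oppr_lt0.
near=> k.
have h1 : ((- (e / 3))%:E < mueta (u k) (t k) G - mu (t k) (shrinkage G (b / 2)))%E.
  apply: (@lt_le_trans _ _ (ereal_inf (range (fun theta =>
      mueta (u k) theta G - mu theta (shrinkage G (b / 2))))))%E.
    by near: k; exact: ucvg hnear.
  by apply: ereal_inf_lbound; exists (t k).
have h2 : (pairing (mu (t k)) g <= mu (t k) (shrinkage G (b / 2)))%E.
  by apply: integral_le_measure => //; exact: borel_shrinkage.
have h3 : (mu tstar (shrinkage G b) <= pairing (mu tstar) g)%E.
  by apply: measure_le_integral => //; exact: borel_shrinkage.
have h4 : fine (pairing (mu tstar) g) - e / 3 <= fine (pairing (mu (t k)) g).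
  by near: k; apply: cvgr_ge (fine_tcvg tg) _ _; rewrite ltrBlDr ltrDl.
have mG : mueta (u k) (t k) G \is a fin_num.
  by apply: off_measure_fin (hmueta _ (u0 k)) r0 _ Gr; exact: borel_open.
have := fine_le (pairing_fin (hmu (t k)) tg) (Gfin _ _ (hmu (t k)) b20) h2.
have := fine_le (Gfin _ _ (hmu tstar) b0) (pairing_fin (hmu tstar) tg) h3.
move: h1; rewrite -(fineK mG) -(fineK (Gfin _ _ (hmu (t k)) b20)) -EFinB lte_fin/=.
move=> h1 h3' h2'; lra.
Unshelve. all: by end_near. Qed.

Lemma set_bounds_cvg_seq f : set_bounds -> test_fun CC f ->
  pairing (mueta (u k) (t k)) f @[k --> \oo] --> pairing (mu tstar) f.
Proof.
move=> hiii; apply: portmanteau_sets => //.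
- by move=> k; exact: hmueta.
- by move=> F r e cF r0 Fr e0; exact: set_bounds_closed_seq hiii cF r0 Fr e0.
- by move=> G r e oG r0 Gr e0; exact: set_bounds_open_seq hiii oG r0 Gr e0.
Qed.

End Equivalence.

Theorem theorem2p2 (R : realType) (S : completeMetricType R) (CC : set S)
    (Theta : Type)
    (mueta : R -> Theta -> {measure set (borel S) -> \bar R})
    (mu : Theta -> {measure set (borel S) -> \bar R})
    (hS : separable S)
    (hCC : measurable (CC : set (borel S)))
    (hmueta : forall eta theta, 0 < eta -> off_measure CC (mueta eta theta))
    (hmu : forall theta, off_measure CC (mu theta))
    (hseq : forall t : nat -> Theta,
      exists (n_ : nat -> nat) (tstar : Theta),
        increasing_seq n_ /\
        forall f, test_fun CC f ->
          pairing (mu (t (n_ k))) f @[k --> \oo] --> pairing (mu tstar) f) :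
  let i := unif_cvg_off CC mueta mu in
  let ii := forall f : S -> R, test_fun CC f -> unif_continuous f ->
    unif_gap mueta mu f eta @[eta --> 0^'+] --> 0%E in
  let iii := forall (eps : R) (F G : set S), 0 < eps ->
    closed F -> bounded_away F CC -> open G -> bounded_away G CC ->
    (limf_esup (fun eta : R => ereal_sup (range (fun theta =>
        mueta eta theta F - mu theta (enlargement F eps)))) 0%R^'+ <= 0)%E /\
    (0 <= limf_einf (fun eta : R => ereal_inf (range (fun theta =>
        mueta eta theta G - mu theta (shrinkage G eps)))) 0%R^'+)%E in
  let iv := forall F G : set S,
    closed F -> bounded_away F CC -> open G -> bounded_away G CC ->
    (limf_esup (fun eta : R => ereal_sup (range (fun theta =>
        mueta eta theta F))) 0%R^'+
      <= ereal_sup (range (fun theta => mu theta F)))%E /\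
    (ereal_inf (range (fun theta => mu theta G))
      <= limf_einf (fun eta : R => ereal_inf (range (fun theta =>
        mueta eta theta G))) 0%R^'+)%E in
  [/\ i <-> ii, ii <-> iii & (i \/ ii \/ iii -> iv)].
Proof.
move=> i ii iii iv.
have i_ii : i -> ii by move=> hi f tf _; exact: hi.
have ii_iii : ii -> iii by exact: cvg_on_unif_continuous_set_bounds.
have iii_i : iii -> i.
  move=> hiii f tf; apply/unif_gap_cvgP => e e0.
  apply: (near_unif_of_seq hseq) => u t tstar u0 ucvg tcvg.
  have h1 := fine_tcvg hmu tcvg tf.
  have := set_bounds_cvg_seq hmueta hmu u0 ucvg tcvg hiii tf.
  rewrite -(fineK (pairing_fin (hmu tstar) tf)) => /fine_cvg h2.
  (* Both pairings tend to the same limit under [mu tstar], so their difference is eventually within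
     [e]. *)
  have : fine (pairing (mu (t k)) f) - fine (pairing (mueta (u k) (t k)) f)
      @[k --> \oo] --> fine (pairing (mu tstar) f) - fine (pairing (mu tstar) f).
    exact: cvgB.
  rewrite subrr => /cvgrPdist_le/(_ _ e0)/filter_ex[k].
  rewrite sub0r normrN => hk; exists k.
  have /fineK <- := pairing_fin (hmu (t k)) tf.
  have /fineK <- := pairing_fin (hmueta _ (t k) (u0 k)) tf.
  by rewrite -EFinB abse_EFin lee_fin distrC.
have iii_iv : iii -> iv.
  move=> hiii F G cF /bounded_awayP[rF rF0 Fr] oG /bounded_awayP[r r0 Gr]; split.
  - apply: limf_esup_le_near => e e0.
    suff H : \forall eta \near 0^'+, forall theta,
        (mueta eta theta F <= ereal_sup (range (fun theta => mu theta F)) + e%:E)%E.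
      by apply: filterS H => eta H; apply: ge_ereal_sup => _ [theta _ <-].
    apply: (near_unif_of_seq hseq) => u t tstar u0 ucvg tcvg.
    have /filter_ex[k hk] :=
      set_bounds_closed_seq hmueta hmu u0 ucvg tcvg hiii cF rF0 Fr e0.
    exists k; apply: (@le_trans _ _ (mu tstar F + e%:E)%E).
      have fin m : off_measure CC m -> m F \is a fin_num.
        by move=> mC; apply: off_measure_fin mC rF0 _ Fr; exact: borel_closed.
      rewrite -(fineK (fin _ (hmu tstar))) -(fineK (fin _ (hmueta _ (t k) (u0 k)))).
      by rewrite -EFinD lee_fin.
    (* The limit measure is a member of the family, so the supremum over [Theta] dominates it. *)
    by rewrite leeD2r//; apply: ereal_sup_ubound; exists tstar.
  - apply: limf_einf_ge_near => e e0.
    suff H : \forall eta \near 0^'+, forall theta,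
        (ereal_inf (range (fun theta => mu theta G)) - e%:E <= mueta eta theta G)%E.
      by apply: filterS H => eta H; apply: le_ereal_inf_tmp => _ [theta _ <-].
    apply: (near_unif_of_seq hseq) => u t tstar u0 ucvg tcvg.
    have /filter_ex[k hk] :=
      set_bounds_open_seq hmueta hmu u0 ucvg tcvg hiii oG r0 Gr e0.
    exists k; apply: (@le_trans _ _ (mu tstar G - e%:E)%E).
      by rewrite leeB//; apply: ereal_inf_lbound; exists tstar.
    have fin m : off_measure CC m -> m G \is a fin_num.
      by move=> mC; apply: off_measure_fin mC r0 _ Gr; exact: borel_open.
    rewrite -(fineK (fin _ (hmu tstar))) -(fineK (fin _ (hmueta _ (t k) (u0 k)))).
    by rewrite -EFinB lee_fin.
split; [split=> // hii|split=> // hiii|].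
- exact/iii_i/ii_iii.
- exact/i_ii/iii_i.
- by move=> [/i_ii/ii_iii|[/ii_iii|]]; exact: iii_iv.
Qed.
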